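(* Let $b\in\mathbb{R}^n\setminus\mathbb{Z}^n$. For every minimal valid tuple $(\pi,\alpha)$ for $I_b$, there exists a unique additive function $\theta:\mathbb{R}^n\to\mathbb{R}$ such that $\theta(p)=0$ for every $p\in\mathbb{Q}^n$ and the tuple $(\pi',\alpha')=(\pi-\theta,\alpha-\theta(b))$ is a minimal valid tuple for $I_b$ satisfying $\pi'\ge0$.
   Context: $I_b$ is the set of finite-support functions $y:\mathbb{R}^n\to\mathbb{Z}_+$ such that $\sum_{p\in\mathbb{R}^n}p\,y(p)\in b+\mathbb{Z}^n$. A tuple $(\pi,\alpha)$ with $\pi:\mathbb{R}^n\to\mathbb{R}$ and $\alpha\in\mathbb{R}$ is valid for $I_b$ if $\sum_{p}\pi(p)y(p)\ge\alpha$ for all $y\in I_b$. It is minimal if there is no $\pi'\neq\pi$ with $\pi'\le\pi$ pointwise such that $(\pi',\alpha)$ is valid for $I_b$. A function $\theta:\mathbb{R}^n\to\mathbb{R}$ is additive if $\theta(u+v)=\theta(u)+\theta(v)$ for all $u,v\in\mathbb{R}^n$. *)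

(* Defs.v *)
From mathcomp Require Import all_boot all_order all_algebra.
From mathcomp Require Import finmap.
From mathcomp Require Import all_classical reals.

Set Implicit Arguments.
Unset Strict Implicit.
Unset Printing Implicit Defensive.

Import Order.TTheory GRing.Theory Num.Theory.

Local Open Scope classical_set_scope.
Local Open Scope ring_scope.

Section ValidTuples.
Variables (R : realType) (n : nat).

Definition int_vec : set 'rV[R]_n := [set z | forall i, z ord0 i \is a Num.int].

Definition rat_vec : set 'rV[R]_n :=
  [set p | forall i, exists q : rat, p ord0 i = ratr q].

Definition infinite_relaxation (b : 'rV[R]_n) :
    set {fsfun 'rV[R]_n -> nat with 0%N} :=
  [set y | exists2 z, int_vec z & \sum_(p <- finsupp y) p *+ y p = b + z].

Definition valid (b : 'rV[R]_n) (pi : 'rV[R]_n -> R) (alpha : R) : Prop :=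
  forall y, infinite_relaxation b y ->
    alpha <= \sum_(p <- finsupp y) pi p *+ y p.

Definition minimal (b : 'rV[R]_n) (pi : 'rV[R]_n -> R) (alpha : R) : Prop :=
  ~ exists pi' : 'rV[R]_n -> R,
      [/\ pi' <> pi, forall p, pi' p <= pi p & valid b pi' alpha].

Definition minimal_valid (b : 'rV[R]_n) (pi : 'rV[R]_n -> R) (alpha : R) : Prop :=
  valid b pi alpha /\ minimal b pi alpha.

Definition is_additive (theta : 'rV[R]_n -> R) : Prop :=
  forall u v, theta (u + v) = theta u + theta v.

End ValidTuples.

(* Main.v *)
(** A minimal [pi] is subadditive and vanishes on integer vectors, so the
    Fekete slope [rho x = inf_(k > 0) pi (k x) / k] is finite, subadditive, at
    most [pi], and zero on rational vectors.  Lowering [pi] at a single point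
    [p] by a small amount preserves validity unless [pi p + pi (b - p) = alpha]
    or [pi p <= - rho (- p)].  If [rho p + rho (- p) > 0], the second case is
    excluded at every multiple [m p], and the first one contradicts
    [pi (m p) + pi (b - m p) >= m (rho p + rho (- p)) - pi (- b)] for large [m].
    So [rho] is odd, hence additive, and [theta = rho] works.  Any additive
    [theta <= pi] satisfies [theta <= rho], hence equals [rho]. *)
Require Import Defs.
From mathcomp Require Import all_boot all_order all_algebra.
From mathcomp Require Import finmap.
From mathcomp Require Import all_classical reals.
From mathcomp Require Import ring lra.

Set Implicit Arguments.
Unset Strict Implicit.
Unset Printing Implicit Defensive.

Import Order.TTheory GRing.Theory Num.Theory.

Local Open Scope ring_scope.

(** * Finitely supported multiplicities as finite sequences *)

Section FiniteSupportAsSeq.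
Variables (T : choiceType).

Lemma sum_fsfun_flatten (V : zmodType) (y : {fsfun T -> nat with 0%N})
    (F : T -> V) :
  \sum_(p <- flatten [seq nseq (y p) p | p <- finsupp y]) F p =
  \sum_(p <- finsupp y) F p *+ y p.
Proof.
rewrite big_flatten big_map; apply: eq_bigr => p _.
by rewrite big_nseq -Monoid.iteropE.
Qed.

(** One [y] serves all [V] and [F], so it carries both the vector constraint and the real
    objective. *)
Lemma exists_fsfun_sum (s : seq T) : exists y : {fsfun T -> nat with 0%N},
  forall (V : zmodType) (F : T -> V),
    \sum_(p <- finsupp y) F p *+ y p = \sum_(p <- s) F p.
Proof.
pose y : {fsfun T -> nat with 0%N} :=
  [fsfun p in seq_fset tt s => count_mem p s].
have yE p : y p = count_mem p s.
  rewrite fsfunE seq_fsetE; case: ifPn => // ps.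
  by apply/esym/eqP; rewrite -leqn0 leqNgt -has_count has_pred1.
exists y => V F; rewrite -(big_undup_iterop_count _ s xpredT F).
rewrite (perm_big (undup s)) /=; last first.
  apply: uniq_perm; rewrite ?undup_uniq ?fset_uniq // => p.
  by rewrite mem_finsupp yE mem_undup -lt0n -has_count has_pred1.
by apply: eq_bigr => p _; rewrite yE.
Qed.

End FiniteSupportAsSeq.

Lemma archimedean_le0 (R : realType) (x M : R) :
  (forall k : nat, k%:R * x <= M) -> x <= 0.
Proof.
move=> h; rewrite leNgt; apply/negP => x0.
have := Num.Theory.archi_boundP (normr_ge0 (M / x)).
set k := Num.bound _ => hk.
have := h k; rewrite -ler_pdivlMr // => hk'.
by have := ler_norm (M / x); lra.
Qed.

(** * Slopes of subadditive functions on an abelian group *)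

Section SubadditiveSlope.
Variables (R : realType) (V : zmodType) (pi : V -> R).
Hypothesis pi_sub : forall u v, pi (u + v) <= pi u + pi v.
Hypothesis pi_0 : pi 0 = 0.

Lemma subadditive_mulrn x k : pi (x *+ k) <= k%:R * pi x.
Proof.
elim: k => [|k IH]; first by rewrite mulr0n pi_0 mul0r.
by rewrite mulrS (le_trans (pi_sub _ _)) // -natr1; lra.
Qed.

Lemma subadditive_sum (s : seq V) (P : pred V) :
  pi (\sum_(p <- s | P p) p) <= \sum_(p <- s | P p) pi p.
Proof.
elim/big_rec2: _ => [|p a x _ IH]; first by rewrite pi_0.
by rewrite (le_trans (pi_sub _ _)) // lerD2l.
Qed.

Lemma subadditive_opp x : - pi (- x) <= pi x.
Proof. by have := pi_sub x (- x); rewrite subrr pi_0; lra. Qed.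

Definition slope_set (x : V) : set R :=
  [set pi (x *+ k.+1) / k.+1%:R | k in [set: nat]]%classic.

Definition slope (x : V) : R := inf (slope_set x).

(** This makes the [inf] in [slope] meaningful; the bound [- pi (- x)] comes from
    [0 <= pi (k x) + pi (- k x)]. *)
Lemma slope_has_lbound x : has_lbound (slope_set x).
Proof.
exists (- pi (- x)) => _ [k _ <-].
rewrite ler_pdivlMr ?ltr0n //.
have := subadditive_opp (x *+ k.+1); rewrite -mulNrn.
by have := subadditive_mulrn (- x) k.+1; lra.
Qed.

Lemma slope_mul_le x k : k%:R * slope x <= pi (x *+ k).
Proof.
case: k => [|k]; first by rewrite mulr0n pi_0 mul0r.
rewrite mulrC -ler_pdivlMr ?ltr0n //.
by apply: ge_inf; [exact: slope_has_lbound | exists k].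
Qed.

Lemma slope_le x : slope x <= pi x.
Proof. by have := slope_mul_le x 1; rewrite mul1r mulr1n. Qed.

Lemma le_slope x t :
  (forall k, k.+1%:R * t <= pi (x *+ k.+1)) -> t <= slope x.
Proof.
move=> h; apply: lb_le_inf; first by exists (pi (x *+ 1) / 1); exists 0%N.
by move=> _ [k _ <-]; rewrite ler_pdivlMr ?ltr0n // mulrC.
Qed.

Lemma slope_mulrn x m : m%:R * slope x <= slope (x *+ m).
Proof.
apply: le_slope => k.
by rewrite -mulrnA mulrA -natrM mulnC slope_mul_le.
Qed.

(** Two independent indices, joined through the multiple [k l] of [u + v], let the two infima be
    taken one after the other. *)
Lemma slope_subadditive u v : slope (u + v) <= slope u + slope v.
Proof.
have key k l : k.+1%:R * l.+1%:R * slope (u + v) <=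
    l.+1%:R * pi (u *+ k.+1) + k.+1%:R * pi (v *+ l.+1).
  rewrite -natrM (le_trans (slope_mul_le _ _)) // mulrnDl.
  rewrite (le_trans (pi_sub _ _)) // lerD //.
    by rewrite mulrnA subadditive_mulrn.
  by rewrite mulnC mulrnA subadditive_mulrn.
rewrite -lerBlDr; apply: le_slope => k; set S := slope (u + v) in key *.
have k0 : (0 : R) < k.+1%:R by rewrite ltr0n.
suff : (k.+1%:R * S - pi (u *+ k.+1)) / k.+1%:R <= slope v.
  by rewrite ler_pdivrMr //; lra.
apply: le_slope => l; rewrite mulrA ler_pdivrMr //.
by have := key k l; lra.
Qed.

Lemma slope0 : slope 0 = 0.
Proof.
apply/eqP; rewrite eq_le; apply/andP; split.
  by have := slope_le 0; rewrite pi_0.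
by apply: le_slope => k; rewrite mulr0 mul0rn pi_0.
Qed.

Lemma slope_addN_ge0 x : 0 <= slope x + slope (- x).
Proof. by rewrite -slope0 -(subrr x) slope_subadditive. Qed.

Hypothesis slope_addN_le0 : forall x, slope x + slope (- x) <= 0.

(** Oddness turns subadditivity at [- u] and [- v] into the reverse inequality. *)
Lemma slope_additive u v : slope (u + v) = slope u + slope v.
Proof.
apply/eqP; rewrite eq_le slope_subadditive /=.
have := slope_subadditive (- u) (- v); rewrite -opprD.
have := slope_addN_le0 u; have := slope_addN_le0 v.
by have := slope_addN_ge0 (u + v); lra.
Qed.

Lemma additive_le_slopeE (theta : V -> R) :
  (forall u v, theta (u + v) = theta u + theta v) ->
  (forall x, theta x <= pi x) -> theta =1 slope.
Proof.
move=> thetaD theta_le.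
have theta0 : theta 0 = 0 by have := thetaD 0 0; rewrite addr0; lra.
have thetaN x : theta (- x) = - theta x.
  by have := thetaD x (- x); rewrite subrr theta0; lra.
have thetaM x k : theta (x *+ k) = k%:R * theta x.
  elim: k => [|k IH]; first by rewrite mulr0n theta0 mul0r.
  by rewrite mulrS thetaD IH -natr1; lra.
have le x : theta x <= slope x by apply: le_slope => k; rewrite -thetaM.
move=> x; apply/eqP; rewrite eq_le le /=.
by have := slope_addN_le0 x; have := le (- x); rewrite thetaN; lra.
Qed.

End SubadditiveSlope.

(** * Integer and rational vectors *)

Section IntVec.
Variables (R : realType) (n : nat).
Implicit Types z : 'rV[R]_n.

Lemma int_vec0 : int_vec (0 : 'rV[R]_n).
Proof. by move=> i; rewrite mxE. Qed.

Lemma int_vecD z w : int_vec z -> int_vec w -> int_vec (z + w).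
Proof. by move=> hz hw i; rewrite mxE rpredD. Qed.

Lemma int_vecN z : int_vec z -> int_vec (- z).
Proof. by move=> hz i; rewrite mxE rpredN. Qed.

Lemma int_vec_rat_vec z : int_vec z -> rat_vec z.
Proof.
move=> hz i; have /intrP [m ->] := hz i.
by exists m%:~R; rewrite ratr_int.
Qed.

Lemma rat_vec_mulrn_int z : rat_vec z -> exists k, int_vec (z *+ k.+1).
Proof.
(* The product of the denominators of all coordinates clears each of them. *)
move=> /choice [f hf]; pose q := (\prod_i `|denq (f i)|)%N.
have q0 : (0 < q)%N by rewrite prodn_gt0 // => i; rewrite absz_gt0 denq_neq0.
exists q.-1; rewrite prednK // => i.
rewrite mulmxnE hf /q (bigD1 i) //= mulrnA rpredMn //.
rewrite -mulr_natr pmulrn absz_denq -[(denq _)%:~R](ratr_int R) -rmorphM /=.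
by rewrite -numqE ratr_int intr_int.
Qed.

End IntVec.

(** * Validity, minimality and additive shifts *)

Section ValidTuples.
Variables (R : realType) (n : nat) (b : 'rV[R]_n).
Implicit Types (f pi theta : 'rV[R]_n -> R) (alpha : R).

(** With sequences, entries can be appended, deleted or split by list operations. *)
Lemma validP f alpha : valid b f alpha <->
  forall s z, int_vec z -> \sum_(p <- s) p = b + z ->
    alpha <= \sum_(p <- s) f p.
Proof.
split=> [h s z hz hs | h y [z hz hy]].
  have [y hy] := exists_fsfun_sum s; rewrite -hy.
  by apply: h; exists z => //; rewrite -hs -(hy _ id).
rewrite -sum_fsfun_flatten; apply: h hz _.
by rewrite (sum_fsfun_flatten y id).
Qed.

(** On a feasible sequence [theta] sums to [theta (b + z) = theta b], a constant. *)
Lemma valid_subD f alpha theta : is_additive theta ->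
  (forall z, int_vec z -> theta z = 0) ->
  valid b f alpha -> valid b (fun p => f p - theta p) (alpha - theta b).
Proof.
move=> thetaD theta_int /validP h; apply/validP => s z hz hs.
have theta_sum (r : seq 'rV[R]_n) :
    \sum_(p <- r) theta p = theta (\sum_(p <- r) p).
  elim/big_rec2: _ => [|p u v _ ->]; last by rewrite thetaD.
  by rewrite theta_int //; exact: int_vec0.
rewrite sumrB theta_sum hs thetaD (theta_int z) // addr0 lerD2r.
exact: h hz hs.
Qed.

Lemma minimal_eq pi f alpha : minimal b pi alpha ->
  (forall p, f p <= pi p) -> valid b f alpha -> f = pi.
Proof.
by move=> pi_min le vf; apply: contrapT => ne; apply: pi_min; exists f.
Qed.

Lemma minimal_subD pi alpha theta : is_additive theta ->
  (forall z, int_vec z -> theta z = 0) ->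
  minimal b pi alpha ->
  minimal b (fun p => pi p - theta p) (alpha - theta b).
Proof.
move=> thetaD theta_int pi_min [f [ne le vf]]; apply: ne.
have vf' : valid b (fun p => f p - - theta p) (alpha - theta b - - theta b).
  apply: valid_subD (vf) => [u v|z hz]; first by rewrite thetaD opprD.
  by rewrite theta_int ?oppr0.
rewrite opprK subrK in vf'.
rewrite -(minimal_eq pi_min _ vf').
  by apply/funext => p; rewrite opprK addrK.
by move=> p; rewrite opprK; have := le p; lra.
Qed.

(** * Structure of minimal valid functions *)

Section Minimal.
Variables (pi : 'rV[R]_n -> R) (alpha : R).
Hypothesis pi_valid : valid b pi alpha.
Hypothesis pi_min : minimal b pi alpha.

Lemma valid_seq s z : int_vec z -> \sum_(p <- s) p = b + z ->
  alpha <= \sum_(p <- s) pi p.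
Proof. by move/validP: pi_valid; exact. Qed.

(** Appending [k] copies of [z] to the sequence [b] keeps it feasible, so a negative [pi z] would
    drive the sum below [alpha]. *)
Lemma valid_int_ge0 z : int_vec z -> 0 <= pi z.
Proof.
move=> hz; rewrite -oppr_le0.
apply: (@archimedean_le0 _ _ (pi b - alpha)) => k.
have hk : int_vec (z *+ k) by move=> i; rewrite mulmxnE rpredMn.
have /valid_seq -/(_ hk) : \sum_(p <- b :: nseq k z) p = b + z *+ k.
  by rewrite big_cons big_nseq -Monoid.iteropE.
rewrite big_cons big_nseq -Monoid.iteropE -[iterop _ _ _ _]/(_ *+ _).
by rewrite -mulr_natl; lra.
Qed.

(** Deleting integer entries keeps a sequence feasible, so [pi] can be lowered to zero on them. *)
Lemma minimal_int_eq0 z : int_vec z -> pi z = 0.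
Proof.
move=> hz; pose f p := if `[< int_vec p >] then 0 else pi p.
suff <- : f = pi by rewrite /f; case: asboolP.
apply: (minimal_eq pi_min) => [p|].
  by rewrite /f; case: asboolP => // /valid_int_ge0.
apply/validP => s w hw hs.
rewrite (bigID (fun p => `[< int_vec p >])) /=.
rewrite big1 ?add0r => [|p]; last by rewrite /f => ->.
rewrite (eq_bigr pi) => [|p]; last by rewrite /f => /negbTE ->.
rewrite -big_filter.
pose t := \sum_(p <- s | `[< int_vec p >]) p.
have ht : int_vec t.
  rewrite /t; elim/big_rec: _ => [|p u /asboolP hp hu]; first exact: int_vec0.
  exact: int_vecD.
apply: (@valid_seq _ (w - t)); first by apply: int_vecD => //; exact: int_vecN.
rewrite big_filter addrA -hs.
rewrite [X in _ = X - _](bigID (fun p => `[< int_vec p >])).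
by rewrite /= addrAC subrr add0r.
Qed.

Lemma minimal_0 : pi 0 = 0.
Proof. by apply: minimal_int_eq0; exact: int_vec0. Qed.

(** Otherwise [pi (u + v)] could be lowered to [pi u + pi v], since each entry [u + v] can be split
    into [u] and [v]. *)
Lemma minimal_subadditive u v : pi (u + v) <= pi u + pi v.
Proof.
rewrite leNgt; apply/negP => lt_uv.
have neu : u != u + v.
  rewrite -subr_eq0 opprD addNKr oppr_eq0; apply/eqP => v0.
  by move: lt_uv; rewrite v0 addr0 minimal_0; lra.
have nev : v != u + v.
  rewrite addrC -subr_eq0 opprD addNKr oppr_eq0; apply/eqP => u0.
  by move: lt_uv; rewrite u0 add0r minimal_0; lra.
pose f p := if p == u + v then pi u + pi v else pi p.
suff fpi : f = pi.
  by have : f (u + v) = pi (u + v); [rewrite fpi | rewrite /f eqxx; lra].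
apply: (minimal_eq pi_min) => [p|].
  by rewrite /f; case: eqP => // ->; exact: ltW.
apply/validP => s w hw hs.
pose r := flatten [seq if p == u + v then [:: u; v] else [:: p] | p <- s].
have -> : \sum_(p <- s) f p = \sum_(p <- r) pi p.
  rewrite big_flatten big_map; apply: eq_bigr => p _; rewrite /f.
  by case: eqP => _; rewrite !big_cons big_nil /= addr0.
apply: (valid_seq hw); rewrite -hs big_flatten big_map.
apply: eq_bigr => p _.
by case: eqP => [->|_]; rewrite !big_cons big_nil /= addr0.
Qed.

Let rho := slope pi.

Lemma valid_symmetric_ge p : alpha <= pi p + pi (b - p).
Proof.
have /valid_seq -/(_ (@int_vec0 R n)) : \sum_(q <- [:: p; b - p]) q = b + 0.
  by rewrite !big_cons big_nil !addr0 addrC subrK.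
by rewrite !big_cons big_nil addr0.
Qed.

(** Splitting [- m p] as [(b - m p) + (- b)] bounds [pi (b - m p)] below linearly in [m]. *)
Lemma slope_sub_le m p : m%:R * rho (- p) - pi (- b) <= pi (b - p *+ m).
Proof.
have := slope_mul_le minimal_subadditive minimal_0 (- p) m.
have := minimal_subadditive (b - p *+ m) (- b).
by rewrite addrAC subrr add0r -mulNrn -/rho; lra.
Qed.

Lemma minimal_symmetric p : 0 < pi p + rho (- p) ->
  pi p + pi (b - p) = alpha.
Proof.
set c := pi p + rho (- p) => c0; apply/eqP.
rewrite eq_le valid_symmetric_ge andbT leNgt; apply/negP => s0.
pose s := pi p + pi (b - p) - alpha.
have {}s0 : 0 < s by rewrite /s; lra.
pose M := 1 + `|alpha + pi (- b)|.
have M0 : 0 < M by rewrite /M ltr_wpDr.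
have ltM : alpha + pi (- b) < M.
  by have := ler_norm (alpha + pi (- b)); rewrite /M; lra.
(* The first bound keeps half of the drift [c]; the second makes [k e > s] imply [k c / 2 > M],
   which exceeds [alpha + pi (- b)]. *)
pose e := Num.min (c / 2) (s * c / 2 / M).
have e0 : 0 < e by rewrite /e lt_min !divr_gt0 ?mulr_gt0.
have ec : e <= c / 2 by rewrite ge_min lexx.
have eM : e * M <= s * c / 2 by rewrite -ler_pdivlMr // ge_min lexx orbT.
pose f q := if q == p then pi p - e else pi q.
suff fpi : f = pi.
  by have : f p = pi p; [rewrite fpi | rewrite /f eqxx; lra].
apply: (minimal_eq pi_min) => [q|].
  by rewrite /f; case: eqP => // ->; lra.
apply/validP => r z hz hr; pose k := count_mem p r.
have sum_p (V : zmodType) (g : 'rV[R]_n -> V) :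
    \sum_(q <- r | q == p) g q = g p *+ k.
  rewrite (eq_bigr (fun=> g p)) => [|q /eqP -> //].
  by rewrite big_const_seq -Monoid.iteropE.
rewrite (bigID (fun q => q == p)) /= sum_p /f eqxx.
rewrite (eq_bigr pi) => [|q /negbTE -> //].
(* The entries other than [p] sum to [b - k p + z], and [z] is absorbed because [pi (- z) = 0]. *)
have rest : pi (b - p *+ k) <= \sum_(q <- r | q != p) pi q.
  have := subadditive_sum minimal_subadditive minimal_0 r (fun q => q != p).
  have -> : \sum_(q <- r | q != p) q = b - p *+ k + z.
    rewrite addrAC -hr [X in _ = X - _](bigID (fun q => q == p)) /=.
    by rewrite (sum_p _ id) addrAC subrr add0r.
  have := minimal_subadditive (b - p *+ k + z) (- z); rewrite addrK.
  by rewrite (minimal_int_eq0 (int_vecN hz)); lra.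
(* The total loss [k e] is covered by the slack [s] when it is at most [s], and
   by the positive drift [c] of [k pi p + pi (b - k p)] when [k] is large. *)
rewrite -mulr_natl; have := slope_sub_le k p.
have [lek|gtk] := lerP (k%:R * e) s.
  clear sum_p; case: k rest lek => [|j] rest lek _.
    have := valid_symmetric_ge 0; rewrite minimal_0 subr0.
    by move: rest; rewrite mulr0n subr0; lra.
  (* Merging [j] of the [j + 1] copies of [p] into the remainder gives an unlowered sum of at least
     [pi p + pi (b - p) = alpha + s]. *)
  rewrite mulrSr opprD addrA in rest.
  have := subadditive_mulrn minimal_subadditive minimal_0 p j.
  have := minimal_subadditive (b - p *+ j - p) (p *+ j).
  rewrite addrAC subrK; move: rest lek; rewrite -natr1 /s; lra.
have ckM : M < k%:R * (c / 2).
  rewrite -(ltr_pM2r e0); apply: (@le_lt_trans _ _ (s * (c / 2))); first by lra.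
  have -> : k%:R * (c / 2) * e = (k%:R * e) * (c / 2) by ring.
  by rewrite ltr_pM2r // divr_gt0.
have : k%:R * e <= k%:R * (c / 2) by rewrite ler_wpM2l.
have -> : k%:R * (pi p - e) = k%:R * c - k%:R * rho (- p) - k%:R * e.
  by rewrite /c; ring.
by move: ckM rest; lra.
Qed.

Lemma minimal_slope_addN_le0 p : rho p + rho (- p) <= 0.
Proof.
rewrite leNgt; apply/negP => c0.
(* The goal is restored with [c0] still in context: its positivity allows [minimal_symmetric] at
   every positive multiple of [p]. *)
suff : rho p + rho (- p) <= 0 by rewrite leNgt c0.
apply: (@archimedean_le0 _ _ (`|alpha + pi (- b)|)) => -[|m].
  by rewrite mul0r.
have mc0 : 0 < m.+1%:R * (rho p + rho (- p)) by rewrite mulr_gt0 ?ltr0n.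
have le1 := slope_mul_le minimal_subadditive minimal_0 p m.+1.
have le2 := slope_mulrn minimal_subadditive minimal_0 (- p) m.+1.
have le3 := slope_sub_le m.+1 p.
have le4 := ler_norm (alpha + pi (- b)).
have : pi (p *+ m.+1) + pi (b - p *+ m.+1) = alpha.
  apply: minimal_symmetric; rewrite -mulNrn.
  by move: le1 le2 mc0; rewrite /rho; lra.
by move: le1 le2 le3; rewrite /rho; lra.
Qed.

Lemma minimal_slope_additive : is_additive rho.
Proof.
exact: (slope_additive minimal_subadditive minimal_0 minimal_slope_addN_le0).
Qed.

(** Some positive multiple of [p] is integer, where [pi] vanishes, so [rho p <= 0]; the same holds
    at [- p], while the two slopes have nonnegative sum. *)
Lemma minimal_slope_rat_eq0 p : rat_vec p -> rho p = 0.
Proof.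
have le0 q : rat_vec q -> rho q <= 0.
  move=> /rat_vec_mulrn_int [k hk].
  have := slope_mul_le minimal_subadditive minimal_0 q k.+1.
  by rewrite minimal_int_eq0 // pmulr_rle0 ?ltr0n.
move=> hp; apply/eqP; rewrite eq_le le0 //=.
have hNp : rat_vec (- p).
  by move=> i; have [q e] := hp i; exists (- q); rewrite mxE e rmorphN.
have := slope_addN_ge0 minimal_subadditive minimal_0 p.
by have := le0 _ hNp; rewrite /rho; lra.
Qed.

End Minimal.

End ValidTuples.

Theorem theorem3p7 (R : realType) (n : nat) (b : 'rV[R]_n)
    (hb : ~ int_vec b) (pi : 'rV[R]_n -> R) (alpha : R)
    (hmin : minimal_valid b pi alpha) :
  exists! theta : 'rV[R]_n -> R,
    [/\ is_additive theta,
        forall p, rat_vec p -> theta p = 0,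
        minimal_valid b (fun p => pi p - theta p) (alpha - theta b)
      & forall p, 0 <= pi p - theta p].
Proof.
have [pi_valid pi_min] := hmin.
have pi_sub := minimal_subadditive pi_valid pi_min.
have pi_0 := minimal_0 pi_valid pi_min.
have rhoD := minimal_slope_additive pi_valid pi_min.
have rho_rat := minimal_slope_rat_eq0 pi_valid pi_min.
have rho_int z (hz : int_vec z) := rho_rat _ (int_vec_rat_vec hz).
exists (slope pi); split.
  split=> // [|p]; last by rewrite subr_ge0 slope_le.
  by split; [exact: valid_subD | exact: minimal_subD].
(* Nonnegativity of [pi - theta] says [theta <= pi], which with additivity forces [theta] to be the
   slope. *)
move=> theta [thetaD _ _ theta_le]; apply/funext => p; apply/esym.
have := minimal_slope_addN_le0 pi_valid pi_min.
move/additive_le_slopeE; apply=> // x.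
by rewrite -subr_ge0.
Qed.
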